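(* Suppose a lifted extremal $(g,X,\Lambda_1,\Lambda_R)$ of the Reinhardt optimal control problem has $\Lambda_R(t)=0$ for all $t$ in an interval $[t_1,t_2]$, $t_1<t_2$. Then the control is at the center of the control set for $t\in(t_1,t_2)$, that is, $u^*(t)=(\frac13,\frac13,\frac13)$ and $Z_{u^*(t)}=\frac13J$; and this determines an arc of the circle as a singular extremal: the extremal is singular on this interval and the boundary curves $\sigma_j(t)=g(t)e_{2j}^*$ trace, for $t\in(t_1,t_2)$, arcs of the unit circle up to a fixed transformation in $\mathrm{SL}_2(\mathbb{R})$.
   Context: For $A,B\in\mathfrak{sl}_2(\mathbb{R})$ write $\langle A,B\rangle=\mathrm{trace}(AB)$, $[A,B]=AB-BA$; $J=\begin{pmatrix}0&-1\\ 1&0\end{pmatrix}$; $e_j^*=(\cos(\pi j/3),\sin(\pi j/3))$. The control set is the simplex $U_T=\{u\in\mathbb{R}^3: u_i\ge0,\ u_0+u_1+u_2=1\}$ and $$Z_u=\begin{pmatrix}\frac{u_1-u_2}{\sqrt3}&\frac{u_0-2u_1-2u_2}{3}\\ u_0&\frac{u_2-u_1}{\sqrt3}\end{pmatrix}.$$ The Reinhardt optimal control problem is: $g'=gX$, $X'=[Z_u,X]/\langle Z_u,X\rangle$ on $\mathrm{SL}_2(\mathbb{R})\times\mathfrak{sl}_2(\mathbb{R})$, $u(t)\in U_T$, minimizing $-\frac32\int_0^{t_f}\langle J,X\rangle dt$ with free terminal time; here $\det X=1$ and, with $X=\begin{pmatrix}a&b\\ c&-a\end{pmatrix}$, the star conditions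 $\sqrt3|a|<c$, $3b+c<0$ hold. A lifted extremal (Pontryagin Maximum Principle) consists of $(g,X,\Lambda_1,\Lambda_R)$ with $\Lambda_1,\Lambda_R\in\mathfrak{sl}_2(\mathbb{R})$, $\langle\Lambda_R,X\rangle=0$, a constant $\lambda_{cost}\le0$ and a control $u^*(t)\in U_T$ such that (for almost every $t$), with $P=Z_{u^*}/\langle Z_{u^*},X\rangle$: $g'=gX$, $X'=[P,X]$, $\Lambda_1'=[\Lambda_1,X]$, $\Lambda_R'=[P,\Lambda_R]-\langle\Lambda_R,P\rangle[P,X]+[-\Lambda_1+\frac32\lambda_{cost}J,X]$; the Hamiltonian $\mathcal{H}=\langle\Lambda_1-\frac32\lambda_{cost}J,X\rangle-\frac{\langle\Lambda_R,Z_u\rangle}{\langle X,Z_u\rangle}$ is maximized over $u\in U_T$ at $u^*(t)$ and vanishes identically along the trajectory; and $(\lambda_{cost},\Lambda_1,\Lambda_R)$ is never zero. An extremal is singular if on an open time interval the maximization of $\mathcal{H}$ over the control set fails to determine $u^*$ uniquely. Statements about the control hold up to modification on a null set of times. *)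

(* Defs.v *)
From HB Require Import structures.
From mathcomp Require Import all_boot all_order all_algebra.
From mathcomp Require Import all_classical all_reals all_analysis.

Set Implicit Arguments.
Unset Strict Implicit.
Unset Printing Implicit Defensive.

Import Order.TTheory GRing.Theory Num.Theory.
Import numFieldNormedType.Exports.

Local Open Scope classical_set_scope.
Local Open Scope ring_scope.

Section Reinhardt.
Variable R : realType.
Implicit Types (A B X Z : 'M[R]_2) (u v : 'rV[R]_3).

Definition mx2 (a b c d : R) : 'M[R]_2 :=
  \matrix_(i < 2, j < 2)
    if i == 0 then (if j == 0 then a else b) else (if j == 0 then c else d).

Definition Jmx : 'M[R]_2 := mx2 0 (-1) 1 0.

Definition SL2 A := \det A = 1.
Definition sl2 A := \tr A = 0.

Definition brk A B : 'M[R]_2 := A *m B - B *m A.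
Definition trf A B : R := \tr (A *m B).

Definition unit_vec (x : R) : 'cV[R]_2 :=
  \col_(i < 2) if i == 0 then cos x else sin x.

Definition estar (j : nat) : 'cV[R]_2 := unit_vec (pi * j%:R / 3).

Definition simplexU u : Prop :=
  (forall i, 0 <= u 0 i) /\ \sum_(i < 3) u 0 i = 1.

Definition Zmx u : 'M[R]_2 :=
  let u0 := u 0 0 in let u1 := u 0 1 in let u2 := u 0 2 in
  mx2 ((u1 - u2) / Num.sqrt 3) ((u0 - 2 * u1 - 2 * u2) / 3)
      u0                       ((u2 - u1) / Num.sqrt 3).

(* The quotient is a genuine one when [sl2 X], [star X] and [simplexU u] hold:
   then [trf (Zmx u) X < 0]. *)
Definition Pmx u X : 'M[R]_2 := (trf (Zmx u) X)^-1 *: Zmx u.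

Definition star X : Prop :=
  let a := X 0 0 in let b := X 0 1 in let c := X 1 0 in
  Num.sqrt 3 * `|a| < c /\ 3 * b + c < 0.

Definition hamiltonian (lcost : R) X (L1 LR : 'M[R]_2) u : R :=
  trf (L1 - (3 / 2 * lcost) *: Jmx) X - trf LR (Zmx u) / trf X (Zmx u).

Definition hmaximizer (lcost : R) X (L1 LR : 'M[R]_2) u : Prop :=
  simplexU u /\
  forall v, simplexU v ->
    hamiltonian lcost X L1 LR v <= hamiltonian lcost X L1 LR u.

Definition abs_continuous (V : normedModType R) (a b : R) (f : R -> V) : Prop :=
  forall e : R, 0 < e -> exists2 d : R, 0 < d &
    forall (n : nat) (s t : 'I_n -> R),
      (forall i, [/\ a <= s i, s i <= t i & t i <= b]) ->
      trivIset setT (fun i => `]s i, t i[%classic) ->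
      \sum_(i < n) (t i - s i) < d ->
      \sum_(i < n) `|f (t i) - f (s i)| < e.

(* Trajectories are curves on [0, tf], with values outside that interval
   irrelevant; the differential equations are understood in the sense of
   Caratheodory (absolutely continuous solutions, equations almost
   everywhere), and the control is only significant up to null sets.
   No endpoint or transversality conditions are imposed. *)
Record lifted_extremal (tf : R) (g X L1 LR : R -> 'M[R]_2) (lcost : R)
    (u : R -> 'rV[R]_3) : Prop := LiftedExtremal {
  le_tf_gt0 : 0 < tf;
  le_u_meas : forall i, measurable_fun `[0, tf] (fun t => u t 0 i);
  le_u_simplex : \forall t \ae (@lebesgue_measure R),
    t \in `[0, tf] -> simplexU (u t);
  le_g_ac : abs_continuous 0 tf g;
  le_X_ac : abs_continuous 0 tf X;
  le_L1_ac : abs_continuous 0 tf L1;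
  le_LR_ac : abs_continuous 0 tf LR;
  le_g_SL2 : forall t, t \in `[0, tf] -> SL2 (g t);
  le_X_sl2 : forall t, t \in `[0, tf] -> sl2 (X t);
  le_L1_sl2 : forall t, t \in `[0, tf] -> sl2 (L1 t);
  le_LR_sl2 : forall t, t \in `[0, tf] -> sl2 (LR t);
  le_X_det : forall t, t \in `[0, tf] -> \det (X t) = 1;
  le_X_star : forall t, t \in `[0, tf] -> star (X t);
  le_LR_X : forall t, t \in `[0, tf] -> trf (LR t) (X t) = 0;
  le_lcost : lcost <= 0;
  le_ode : \forall t \ae (@lebesgue_measure R), t \in `]0, tf[ ->
    let P := Pmx (u t) (X t) in
    [/\ is_derive t (1 : R) g (g t *m X t),
        is_derive t (1 : R) X (brk P (X t)),
        is_derive t (1 : R) L1 (brk (L1 t) (X t))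
      & is_derive t (1 : R) LR
          (brk P (LR t) - trf (LR t) P *: brk P (X t)
           + brk (- L1 t + (3 / 2 * lcost) *: Jmx) (X t))];
  le_max : \forall t \ae (@lebesgue_measure R), t \in `[0, tf] ->
    hmaximizer lcost (X t) (L1 t) (LR t) (u t);
  le_ham0 : \forall t \ae (@lebesgue_measure R), t \in `[0, tf] ->
    hamiltonian lcost (X t) (L1 t) (LR t) (u t) = 0;
  le_nontrivial : forall t, t \in `[0, tf] ->
    ~ [/\ lcost = 0, L1 t = 0 & LR t = 0]
}.

Definition singular_on (t1 t2 : R) (X L1 LR : R -> 'M[R]_2) (lcost : R) : Prop :=
  forall t, t \in `]t1, t2[ ->
    exists v w, [/\ v <> w, hmaximizer lcost (X t) (L1 t) (LR t) v
                          & hmaximizer lcost (X t) (L1 t) (LR t) w].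

(* On the open interval, the curve [s] runs through the image under [h] of an
   arc of the unit circle: its angle [theta] is a continuous bijection onto an
   open interval of angles (which may be longer than [2 * pi]). *)
Definition traces_circle_arc (h : 'M[R]_2) (t1 t2 : R) (s : R -> 'cV[R]_2) : Prop :=
  exists (theta : R -> R) (alpha beta : R),
    [/\ {in `]t1, t2[, continuous theta},
        set_bij `]t1, t2[ `]alpha, beta[ theta
      & forall t, t \in `]t1, t2[ -> s t = h *m unit_vec (theta t)].

Definition sigma (g : R -> 'M[R]_2) (j : nat) (t : R) : 'cV[R]_2 :=
  g t *m estar (2 * j).

End Reinhardt.

Arguments Jmx {R}.

(* Main.v *)
Require Import Defs.
From HB Require Import structures.
From mathcomp Require Import all_boot all_order all_algebra.
From mathcomp Require Import all_classical all_reals all_analysis.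
From mathcomp Require Import measurable_realfun ring lra.

Set Implicit Arguments.
Unset Strict Implicit.
Unset Printing Implicit Defensive.

Import Order.TTheory GRing.Theory Num.Theory.
Import numFieldNormedType.Exports.

Local Open Scope classical_set_scope.
Local Open Scope ring_scope.

(** On [[t1, t2]] the curve [LR] is constant, so its equation there reduces to
    [[M, X] = 0] for [M = L1 - (3/2) lcost J], and the Hamiltonian reduces to
    [<M, X>], which vanishes.  As [\det X = 1], a matrix of [sl2] commuting
    with [X] is a multiple of [X], and [<X, X> = -2]; hence [M = 0]
    ([brk_trf_eq0]).  So [L1] is the constant [(3/2) lcost J], where
    [lcost <> 0] by nontriviality, and [0 = L1' = [L1, X]] makes [X] commute
    with [J]; the determinant and the star condition then leave only [X = J]
    ([brkJ_eq0]).  Now [0 = X' = [P, J]] says that [Zmx u] commutes with [J],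
    which forces the center of the simplex ([brkPJ_eq0]).  All controls
    maximize the Hamiltonian because [LR = 0] removes its dependence on the
    control.  Finally [g' = g J] makes [g] a fixed matrix times the rotation
    of angle [t], so that [sigma] runs through the image of an arc of the unit
    circle ([ae_rotation_ode], [traces_circle_arc_rot]).

    The differential equations hold only almost everywhere.  For [L1] and [X]
    this is harmless: a continuous function which is almost everywhere equal to
    a constant is that constant ([ae_cst_continuous]).  For [g] one needs that
    an absolutely continuous function with derivative zero almost everywhere is
    constant ([abs_continuous_derive0]), applied to the entries of [g t] times
    the rotation of angle [-t]. *)

(** * Absolutely continuous functions with zero derivative *)

(** Compactness of [[a, b]] in the form of an induction: a property that
    propagates across every point of the segment, at a scale depending on the
    point, propagates from end to end.  The supremum of the points reached
    cannot lie before [b]. *)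
Lemma segment_propagation (R : realType) (a b : R) (S : R -> Prop) :
  a <= b -> S a ->
  (forall c, a <= c <= b -> exists2 d : R, 0 < d &
     forall x y, a <= x -> x <= c -> c <= y -> y <= b ->
       c - d < x -> y < c + d -> S x -> S y) ->
  S b.
Proof.
move=> ab Sa gauge; pose T := [set x : R | a <= x <= b /\ S x].
have Ta : T a by rewrite /T/= lexx ab.
have Tb : ubound T b by move=> x [/andP[_ ->]].
have supT : has_sup T by split; [exists a | exists b].
have acb : a <= sup T <= b.
  by rewrite (sup_upper_bound supT Ta)/= (ge_sup (ex_intro _ a Ta) Tb).
have [d d0 step] := gauge _ acb.
have [x [/andP[ax xb] Sx] cdx] := sup_adherent d0 supT.
have xc : x <= sup T by apply: sup_upper_bound => //; rewrite /T/= ax xb.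
have [bd|db] := leP b (sup T + d / 2).
  have /andP[_ cb] := acb.
  by apply: (step x b) => //; rewrite (le_lt_trans bd)// ltrD2l; lra.
have cy : sup T <= sup T + d / 2 by rewrite lerDl; lra.
have Sy : S (sup T + d / 2).
  by apply: (step x _ ax xc cy (ltW db) cdx _ Sx); rewrite ltrD2l; lra.
have /(sup_upper_bound supT) : T (sup T + d / 2).
  by split => //; rewrite (ltW db) andbT (le_trans _ cy)//; case/andP: acb.
by lra.
Qed.

Lemma is_derive0_small_increment (R : realType) (V : normedModType R)
    (f : R -> V) (c e : R) :
  is_derive c (1 : R) f 0 -> 0 < e ->
  exists2 d : R, 0 < d &
    forall x, `|x - c| < d -> `|f x - f c| <= e * `|x - c|.
Proof.
move=> [/derivable_nbhs df f'0] e0; move: df; rewrite f'0 => /eqaddoP/(_ _ e0).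
move=> /nbhs_ballP[d /= d0 dball]; exists d => // x xcd.
have /dball : ball (0 : R) d (x - c) by rewrite /ball/= sub0r normrN.
rewrite /= [X in `|_ - X| <= _](_ : _ = f c + (x - c) *: (0 : V)) //.
by rewrite scaler0 addr0 [_ *: 1]mulr1 subrK.
Qed.

Lemma abs_continuousS (R : realType) (V : normedModType R) (a b c d : R)
    (f : R -> V) :
  a <= c -> d <= b -> abs_continuous a b f -> abs_continuous c d f.
Proof.
move=> ac db acf e /acf[r r0 H]; exists r => // n s t st; apply: H => i.
by have [cs -> td] := st i; rewrite (le_trans ac)// (le_trans td).
Qed.

Lemma sum_itv_length_le (R : realType) (U : set R) (n : nat) (s t : 'I_n -> R) :
  measurable U -> (forall i, s i <= t i) ->
  (forall i, `]s i, t i[%classic `<=` U) ->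
  trivIset setT (fun i => `]s i, t i[%classic) ->
  ((\sum_(i < n) (t i - s i))%:E <= @lebesgue_measure R U)%E.
Proof.
move=> mU st stU triv.
have mitv : forall i, measurable (`]s i, t i[%classic : set R) by [].
have mbig : measurable (\big[setU/set0]_(i < n) (`]s i, t i[%classic : set R)).
  exact: bigsetU_measurable.
have -> : (\sum_(i < n) (t i - s i))%:E =
    @lebesgue_measure R (\big[setU/set0]_(i < n) (`]s i, t i[%classic : set R)).
  rewrite measure_semi_additive_ord// -sumEFin; apply: eq_bigr => i _.
  rewrite [RHS]lebesgue_measure_itv/= lte_fin; case: ltP => [//|ts].
  by rewrite (@le_anti _ _ (s i) (t i)) ?subrr// st ts.
apply: le_measure; rewrite ?inE//.
by elim/big_ind: _ => // A B AU BU x [/AU|/BU].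
Qed.

(** Enclose the points where the derivative is not known to vanish in an open
    set [U] of small measure.  Crossing a point of [U] costs the increment over
    an interval inside [U]; absolute continuity makes the sum of these
    increments small.  Crossing any other point costs at most [e1] times the
    distance travelled.  [segment_propagation] carries this accounting, which is
    the predicate [covered], from [a] to [b]. *)
Lemma abs_continuous_derive0 (R : realType) (V : normedModType R) (a b : R)
    (f : R -> V) :
  a <= b -> abs_continuous a b f ->
  (\forall t \ae (@lebesgue_measure R),
     t \in `]a, b[ -> is_derive t (1 : R) f 0) ->
  f b = f a.
Proof.
move=> ab acf f'0; apply/eqP; rewrite -subr_eq0 -normr_le0.
apply/ler_addgt0Pl => e e0; rewrite addr0.
(* Adding 1 keeps the denominator positive when [a = b]. *)
pose e1 := e / 2 / (b - a + 1).
have ba1 : 0 < b - a + 1 by lra.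
have e10 : 0 < e1 by rewrite !divr_gt0.
have e20 : 0 < e / 2 by rewrite divr_gt0.
have [d d0 acd] := acf _ e20.
(* The endpoints are added since the hypothesis says nothing about them. *)
pose bad : set R :=
  ~` [set t | t \in `]a, b[ -> is_derive t (1 : R) f 0] `|` [set a; b].
have bad0 : (@lebesgue_measure R).-negligible bad.
  apply: negligibleU; first exact: f'0.
  apply: negligibleU; apply/negligibleP => //; exact: lebesgue_measure_set1.
have d20 : 0 < d / 2 by rewrite divr_gt0.
have [U [oU badU muU]] := outer_measure_open_le bad d20.
move: muU; rewrite (negligible_outer_measure _).1// add0e => muU.
pose covered x := exists n (s t : nat -> R),
  [/\ forall i, (i < n)%N ->
        [/\ a <= s i, s i <= t i, t i <= x & `]s i, t i[%classic `<=` U],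
      trivIset `I_n (fun i => `]s i, t i[%classic) &
      `|f x - f a| <= e1 * (x - a) + \sum_(i < n) `|f (t i) - f (s i)|].
suff: covered b.
  move=> [n [s [t [st triv fb]]]].
  have stI (i : 'I_n) := st i (ltn_ord i).
  have trivI : trivIset setT (fun i : 'I_n => `]s i, t i[%classic).
    move=> i j _ _ ij; apply/val_inj.
    exact: (triv i j (ltn_ord i) (ltn_ord j) ij).
  have lt_d : \sum_(i < n) (t i - s i) < d.
    have -> : d = d / 2 + d / 2 by lra.
    rewrite (@le_lt_trans _ _ (d / 2)) ?ltrDl// -lee_fin.
    apply: le_trans muU; apply: (@sum_itv_length_le _ U n s t) => //.
    - exact: open_measurable.
    - by move=> i; case: (stI i).
    - by move=> i; case: (stI i).
  have /ltW/(lerD (lexx (e1 * (b - a)))) := acd n s t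
    (fun i => let: And4 as_ st' tb _ := stI i in And3 as_ st' tb) trivI lt_d.
  move=> /(le_trans fb)/le_trans; apply.
  have : e1 * (b - a) <= e / 2.
    by rewrite /e1 mulrAC ler_pdivrMr// ler_pM2l//; lra.
  by lra.
apply: (segment_propagation ab).
  exists 0%N, (fun=> a), (fun=> a); split => //.
  by rewrite !subrr normr0 mulr0 big_ord0 addr0.
move=> c acb; have [cbad|cgood] := pselect (bad c).
  have [r /= r0 rU] : exists2 r : R, 0 < r & ball c r `<=` U.
    exact/nbhs_ballP/open_nbhs_nbhs/(conj oU (badU _ cbad)).
  exists r => // x y ax xc cy yb rx ry [n [s [t [st triv fx]]]].
  (* [`]x, y[] joins the family; it lies to the right of all the others. *)
  exists n.+1, (fun i => if (i < n)%N then s i else x),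
    (fun i => if (i < n)%N then t i else y); split.
  - move=> i _; case: ifPn => [/st[as_ st' tx stU]|_].
      by rewrite (le_trans tx)// (le_trans xc).
    split => //; first exact: le_trans cy.
    move=> z /=; rewrite in_itv/= => /andP[xz zy]; apply: rU.
    by rewrite /ball/= distrC ltr_distlC; apply/andP; split; lra.
  - have sep i : (i < n)%N -> forall z, `]s i, t i[%classic z -> ~ `]x, y[%classic z.
      move=> /st[_ _ tx _] z /=; rewrite !in_itv/= => /andP[_ zt] /andP[xz _].
      by lra.
    move=> i j; rewrite /= !ltnS => ilen jlen; case: ifPn => [ltin|].
      case: ifPn => [ltjn|_ [z [z1 z2]]]; first exact: triv.
      by case: (sep i ltin z).
    rewrite -leqNgt => lein; case: ifPn => [ltjn [z [z1 z2]]|].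
      by case: (sep j ltjn z).
    rewrite -leqNgt => lejn _; apply/eqP.
    by rewrite eqn_leq (leq_trans ilen lejn) (leq_trans jlen lein).
  - rewrite big_ord_recr/= ltnn.
    under eq_bigr do rewrite ltn_ord.
    rewrite addrA -(subrKA (f x)) addrC (le_trans (ler_normD _ _))// lerD//.
    apply: (le_trans fx); rewrite lerD2r ler_wpM2l ?lerD2r ?(ltW e10)//.
    exact: le_trans cy.
have f'c : is_derive c (1 : R) f 0.
  apply: contrapT => nf; apply: cgood; rewrite /bad.
  have [->|ca] := eqVneq c a; first by right; left.
  have [->|cb] := eqVneq c b; first by right; right.
  left => /=; apply/not_implyP; split => //.
  by case/andP: acb => ac cb'; rewrite in_itv/= !lt_neqAle eq_sym ca ac cb cb'.
have [r r0 small] := is_derive0_small_increment f'c e10.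
exists r => // x y ax xc cy yb rx ry [n [s [t [st triv fx]]]].
exists n, s, t; split => //.
  by move=> i /st[? ? tx ?]; rewrite (le_trans tx)// (le_trans xc).
have -> : e1 * (y - a) = e1 * (y - c) + e1 * (c - x) + e1 * (x - a) by ring.
rewrite -addrA -(subrKA (f x)) (le_trans (ler_normD _ _))// lerD//.
rewrite -(subrKA (f c)) (le_trans (ler_normD _ _))// lerD//.
  by rewrite -(@ger0_norm _ (y - c)) ?subr_ge0// small// ger0_norm; lra.
rewrite distrC -(@ger0_norm _ (c - x)) ?subr_ge0// [in leRHS]distrC small//.
by rewrite distrC ger0_norm; lra.
Qed.

(** * Continuity and operations on absolutely continuous functions *)

Lemma abs_continuous_small_increment (R : realType) (V : normedModType R)
    (a b : R) (f : R -> V) (e : R) :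
  abs_continuous a b f -> 0 < e ->
  exists2 d : R, 0 < d & {in `[a, b] &, forall x y,
    `|x - y| < d -> `|f x - f y| < e}.
Proof.
move=> acf /acf[d d0 small]; exists d => // x y.
wlog xy : x y / x <= y => [wl xab yab xyd|].
  have [xy|/ltW yx] := leP x y; first exact: wl.
  by rewrite distrC wl// distrC.
rewrite !in_itv/= => /andP[ax _] /andP[_ yb].
rewrite distrC ger0_norm ?subr_ge0// => xyd.
have := small 1%N (fun=> x) (fun=> y).
rewrite !big_ord1 distrC; apply => //.
  by move=> i j _ _ _; rewrite !ord1.
Qed.

Lemma abs_continuous_within (R : realType) (V : normedModType R) (a b : R)
    (f : R -> V) :
  abs_continuous a b f -> {within `[a, b], continuous f}.
Proof.
move=> acf; apply/subspace_continuousP => x xab.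
apply/cvgrPdist_lt => e e0.
have [d d0 small] := abs_continuous_small_increment acf e0.
rewrite near_withinE; near=> y => yab; apply: small => //.
Unshelve. all: by end_near. Qed.

Lemma abs_continuous_bounded (R : realType) (V : normedModType R) (a b : R)
    (f : R -> V) :
  abs_continuous a b f ->
  exists2 M : R, 0 < M & {in `[a, b], forall x, `|f x| <= M}.
Proof.
move=> /abs_continuous_within cf.
have /compact_bounded[M [_ fM]] := continuous_compact cf (@segment_compact _ a b).
exists (Num.max M 0 + 1) => [|x xab]; first by rewrite ltr_pwDr// le_max lexx orbT.
by apply: fM; [rewrite ltr_pwDr// le_max lexx|exists x].
Qed.

Lemma abs_continuousD (R : realType) (V : normedModType R) (a b : R)
    (f g : R -> V) :
  abs_continuous a b f -> abs_continuous a b g ->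
  abs_continuous a b (fun x => f x + g x).
Proof.
move=> acf acg e e0; have e20 : 0 < e / 2 by rewrite divr_gt0.
have [[d1 d10 H1] [d2 d20 H2]] := (acf _ e20, acg _ e20).
exists (Num.min d1 d2) => [|n s t st triv]; first by rewrite lt_min d10.
rewrite lt_min => /andP[lt1 lt2].
have lt12 := ltrD (H1 n s t st triv lt1) (H2 n s t st triv lt2).
rewrite [ltRHS]splitr (le_lt_trans _ lt12)//.
by rewrite -big_split ler_sum// => i _; rewrite opprD addrACA ler_normD.
Qed.

Lemma abs_continuousN (R : realType) (V : normedModType R) (a b : R)
    (f : R -> V) :
  abs_continuous a b f -> abs_continuous a b (fun x => - f x).
Proof.
move=> acf e /acf[d d0 small]; exists d => // n s t st triv lt_d.
by under eq_bigr do rewrite -opprD normrN; exact: small.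
Qed.

(** The estimate [|f g (t) - f g (s)| <= N |f t - f s| + M |g t - g s|] needs
    bounds [M] and [N] for both factors, which continuity on a segment gives. *)
Lemma abs_continuousM (R : realType) (a b : R) (f g : R -> R) :
  abs_continuous a b f -> abs_continuous a b g ->
  abs_continuous a b (fun x => f x * g x).
Proof.
move=> acf acg e e0.
have [M M0 fM] := abs_continuous_bounded acf.
have [N N0 gN] := abs_continuous_bounded acg.
have eN : 0 < e / 2 / N by rewrite !divr_gt0.
have eM : 0 < e / 2 / M by rewrite !divr_gt0.
have [[d1 d10 H1] [d2 d20 H2]] := (acf _ eN, acg _ eM).
exists (Num.min d1 d2) => [|n s t st triv]; first by rewrite lt_min d10.
rewrite lt_min => /andP[/(H1 n s t st triv) lt1 /(H2 n s t st triv) lt2].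
have -> : e = N * (e / 2 / N) + M * (e / 2 / M) by field; rewrite !gt_eqF.
rewrite -(ltr_pM2l N0) in lt1; rewrite -(ltr_pM2l M0) in lt2.
apply: le_lt_trans (ltrD lt1 lt2).
rewrite !mulr_sumr -big_split ler_sum//= => i _.
have [as_ st' tb] := st i.
have tab : t i \in `[a, b] by rewrite in_itv/= tb (le_trans as_).
have sab : s i \in `[a, b] by rewrite in_itv/= as_ (le_trans st').
have -> : f (t i) * g (t i) - f (s i) * g (s i) =
  (f (t i) - f (s i)) * g (t i) + f (s i) * (g (t i) - g (s i)) by ring.
rewrite (le_trans (ler_normD _ _))// !normrM lerD//.
  by rewrite mulrC ler_wpM2r// gN.
by rewrite ler_wpM2r// fM.
Qed.

Lemma abs_continuous_mx_coord (R : realType) (m n : nat) (a b : R)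
    (f : R -> 'M[R]_(m, n)) i j :
  abs_continuous a b f -> abs_continuous a b (fun s => f s i j).
Proof.
move=> acf e /acf[d d0 small]; exists d => // k s t st triv lt_d.
apply: le_lt_trans (small k s t st triv lt_d); apply: ler_sum => l _.
rewrite [leRHS]/Num.Def.normr/= mx_normrE.
by apply: le_trans (le_bigmax _ _ (i, j)); rewrite !mxE.
Qed.

Lemma lipschitz_abs_continuous (R : realType) (V : normedModType R) (a b k : R)
    (f : R -> V) :
  0 < k -> (forall x y, `|f x - f y| <= k * `|x - y|) -> abs_continuous a b f.
Proof.
move=> k0 lip e e0; exists (e / k) => [|n s t st _]; first by rewrite divr_gt0.
rewrite ltr_pdivlMr// mulrC; apply: le_lt_trans.
rewrite mulr_sumr; apply: ler_sum => i _; apply: le_trans (lip _ _) _.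
by have [_ st' _] := st i; rewrite ger0_norm ?subr_ge0.
Qed.

Lemma bounded_derive_lipschitz (R : realType) (k : R) (f df : R -> R) :
  (forall x, is_derive x (1 : R) f (df x)) -> (forall x, `|df x| <= k) ->
  forall x y, `|f x - f y| <= k * `|x - y|.
Proof.
move=> f' bnd x y; wlog xy : x y / y <= x => [wl|].
  have [|/ltW] := leP y x; first exact: wl.
  by rewrite distrC (distrC x); exact: wl.
have [|c _ ->] := @MVT_segment _ f df y x xy.
- apply: derivable_within_continuous => z _.
  exact: (@ex_derive _ _ _ _ _ _ _ (f' z)).
- by rewrite normrM ler_wpM2r.
Qed.

Lemma abs_continuous_sin (R : realType) (a b : R) : abs_continuous a b (@sin R).
Proof.
apply: (@lipschitz_abs_continuous _ _ _ _ 1) => //.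
apply: (@bounded_derive_lipschitz _ _ _ cos) => x.
by rewrite ler_norml cos_le1 cos_geN1.
Qed.

Lemma abs_continuous_cos (R : realType) (a b : R) : abs_continuous a b (@cos R).
Proof.
apply: (@lipschitz_abs_continuous _ _ _ _ 1) => //.
apply: (@bounded_derive_lipschitz _ _ _ (fun x => - sin x)) => x.
by rewrite normrN ler_norml sin_le1 sin_geN1.
Qed.

(** * Functions constant almost everywhere *)

#[local] Instance lebesgue_ae_filter (R : realType) :
  Filter (nbhs (almost_everywhere (@lebesgue_measure R))).
Proof. exact: (ae_filter_ringOfSetsType (@lebesgue_measure R)). Qed.

(** A ball has positive measure, so it is not contained in a negligible set. *)
Lemma ae_exists_near (R : realType) (P A : set R) (x : R) :
  (\forall t \ae (@lebesgue_measure R), P t) -> nbhs x A ->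
  exists2 t, A t & P t.
Proof.
move=> aeP /nbhs_ballP[d /= d0 dA]; apply: contrapT => nAP.
have sub : ball x d `<=` ~` [set t | P t].
  by move=> t xt Pt; apply: nAP; exists t => //; exact: dA.
have : @lebesgue_measure R (ball x d) = 0%E.
  apply/negligibleP; first exact: measurable_ball.
  by move: aeP; apply: negligibleS.
rewrite (lebesgue_measure_ball _ (ltW d0)) => /eqP.
by rewrite eqe mulrn_eq0/= gt_eqF.
Qed.

Lemma ae_cst_continuous (R : realType) (V : normedModType R) (t1 t2 : R)
    (f : R -> V) (v : V) :
  {in `]t1, t2[, continuous f} ->
  (\forall t \ae (@lebesgue_measure R), t \in `]t1, t2[ -> f t = v) ->
  forall t, t \in `]t1, t2[ -> f t = v.
Proof.
move=> cf aef t tI; apply/eqP; apply: contrapT => /negP fv.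
have fv0 : 0 < `|f t - v| by rewrite normr_gt0 subr_eq0.
have fNv : \forall s \near t, (s \in `]t1, t2[) /\ (f s != v).
  near=> s; split.
    by near: s; exact: near_in_itvoo.
  have : `|f t - f s| < `|f t - v|.
    by near: s; exact: (cvgrPdist_lt _ _).1 (cf t tI) _ fv0.
  by apply: contraTneq => ->; rewrite ltxx.
have [s [sI fsv] fs] := ae_exists_near aef fNv.
by rewrite fs ?eqxx in fsv.
Unshelve. all: by end_near. Qed.
Lemma locally_constant_is_derive (R : realType) (V : normedModType R)
    (t1 t2 : R) (f : R -> V) (v df : V) (t : R) :
  (forall s, s \in `]t1, t2[ -> f s = v) -> t \in `]t1, t2[ ->
  is_derive t (1 : R) f df -> df = 0.
Proof.
move=> fv tI [_ <-]; rewrite (@near_eq_derive _ _ _ _ (cst v)) ?derive_cst//.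
by near=> s; apply: fv; near: s; exact: near_in_itvoo.
Unshelve. all: by end_near. Qed.

(** * Two by two matrices *)

Lemma sum_ord2 (V : nmodType) (f : 'I_2 -> V) : \sum_(i < 2) f i = f 0 + f 1.
Proof. by rewrite big_ord_recl big_ord1; congr (_ + f _); apply/val_inj. Qed.

Lemma mulmx2E (R : pzSemiRingType) (m n : nat) (A : 'M[R]_(m, 2)) (B : 'M[R]_(2, n))
    i j : (A *m B) i j = A i 0 * B 0 j + A i 1 * B 1 j.
Proof. by rewrite mxE sum_ord2. Qed.

Lemma mxtrace2E (R : pzSemiRingType) (A : 'M[R]_2) : \tr A = A 0 0 + A 1 1.
Proof. exact: sum_ord2. Qed.

Lemma brkE (R : realType) (A B : 'M[R]_2) i j :
  brk A B i j =
    A i 0 * B 0 j + A i 1 * B 1 j - (B i 0 * A 0 j + B i 1 * A 1 j).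
Proof. by rewrite /brk mxE [X in _ + X]mxE !mulmx2E. Qed.

Lemma brkNl (R : realType) (A B : 'M[R]_2) : brk (- A) B = - brk A B.
Proof. by rewrite /brk mulNmx mulmxN opprK opprB addrC. Qed.

Lemma trfE (R : realType) (A B : 'M[R]_2) :
  trf A B = A 0 0 * B 0 0 + A 0 1 * B 1 0 + (A 1 0 * B 0 1 + A 1 1 * B 1 1).
Proof. by rewrite /trf mxtrace2E !mulmx2E. Qed.

Lemma det_mx22 (R : comNzRingType) (A : 'M[R]_2) :
  \det A = A 0 0 * A 1 1 - A 0 1 * A 1 0.
Proof.
rewrite (expand_det_row _ 0) sum_ord2 /cofactor !det_mx11 !mxE /=.
have -> : lift 0 0 = 1 :> 'I_2 by apply/val_inj.
have -> : lift 1 0 = 0 :> 'I_2 by apply/val_inj.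
by rewrite expr0 expr1 mul1r mulN1r mulrN.
Qed.

Lemma mx2_ext (T : Type) (A B : 'M[T]_2) :
  A 0 0 = B 0 0 -> A 0 1 = B 0 1 -> A 1 0 = B 1 0 -> A 1 1 = B 1 1 -> A = B.
Proof.
move=> h00 h01 h10 h11; apply/matrixP => i j.
by have [[->|->] [->|->]] : (i = 0 \/ i = 1) /\ (j = 0 \/ j = 1)
  by split; [case: i|case: j] => -[|[|//]] ?; [left|right|left|right]; apply/val_inj.
Qed.

Lemma sl2E (R : realType) (A : 'M[R]_2) : sl2 A -> A 1 1 = - A 0 0.
Proof. by rewrite /sl2 mxtrace2E addrC => /eqP; rewrite addr_eq0 => /eqP. Qed.

(** * Rigidity of the Lie brackets *)

(** The centralizer of [X] in [sl2] is the line spanned by [X], on which the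
    trace form does not vanish since [<X, X> = - 2 \det X]. *)
Lemma brk_trf_eq0 (R : realType) (M X : 'M[R]_2) :
  sl2 M -> sl2 X -> \det X = 1 -> brk M X = 0 -> trf M X = 0 -> M = 0.
Proof.
move=> /sl2E trM /sl2E trX; rewrite det_mx22 trX => detX com.
have e i j : brk M X i j = 0 by rewrite com mxE.
have := e 0 0; have := e 0 1; have := e 1 0.
rewrite trfE !brkE trM trX.
move: trM detX.
set m := M 0 0; set n := M 0 1; set p := M 1 0.
set a := X 0 0; set b := X 0 1; set c := X 1 0 => trM detX e10 e01 e00 tr0.
have e1 : n * c = p * b by lra.
have e2 : m * b = n * a by lra.
have e3 : p * a = m * c by lra.
have e4 : m * a = - (n * c) by lra.
(* Multiplying by [1 = \det X] turns each entry of [M] into a combination of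
   the quadratic relations above. *)
have expand z : z = - (z * a * a) - z * b * c.
  by rewrite -[LHS]mulr1 -detX; ring.
have m0 : m = 0.
  by rewrite [m]expand e4 e2; ring.
have n0 : n = 0.
  by rewrite [n]expand -e2 (mulrAC m) e4; ring.
have p0 : p = 0.
  by rewrite [p]expand e3 (mulrAC m) e4 -e1; ring.
by apply: mx2_ext; rewrite !mxE ?trM -/m ?m0 ?oppr0.
Qed.

(** The elements of [sl2] commuting with [J] are the multiples of [J]; those of
    determinant one are [J] and [- J], and the sign condition selects [J]. *)
Lemma brkJ_eq0 (R : realType) (X : 'M[R]_2) :
  sl2 X -> \det X = 1 -> 0 < X 1 0 -> brk Jmx X = 0 -> X = Jmx.
Proof.
move=> /sl2E trX; rewrite det_mx22 trX => detX c0 com.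
have e i j : brk Jmx X i j = 0 by rewrite com mxE.
have := e 0 0; have := e 0 1; rewrite !brkE !mxE /= trX => e01 e00.
have a0 : X 0 0 = 0 by lra.
have b0 : X 0 1 = - X 1 0 by lra.
have c1 : X 1 0 = 1.
  have cc : X 1 0 * X 1 0 = 1 by rewrite -[RHS]detX a0 b0; ring.
  have /eqP : (X 1 0 - 1) * (X 1 0 + 1) = 0.
    by transitivity (X 1 0 * X 1 0 - 1); [ring|rewrite cc subrr].
  by rewrite mulf_eq0 subr_eq0 => /orP[/eqP //|/eqP]; lra.
by apply: mx2_ext; rewrite !mxE /= ?trX ?a0 ?b0 ?c1 ?oppr0.
Qed.

Lemma sum_ord3 (V : nmodType) (f : 'I_3 -> V) :
  \sum_(i < 3) f i = f 0 + f 1 + f 2.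
Proof.
rewrite !big_ord_recl big_ord0 addr0 addrA.
by congr (_ + _ + _); congr (f _); apply/val_inj.
Qed.

Lemma Zmx_center (R : realType) :
  Zmx (const_mx (1 / 3) : 'rV[R]_3) = (1 / 3) *: Jmx.
Proof.
by apply: mx2_ext; rewrite /Zmx !mxE /= ?subrr ?mul0r ?mulr0 ?mulr1//; field.
Qed.

(** The pairing [<Zmx u, J>] is [- 2/3] on the whole simplex, so the scalar
    factor in [Pmx u J] is invertible and [Zmx u] itself commutes with [J]. *)
Lemma brkPJ_eq0 (R : realType) (u : 'rV[R]_3) :
  simplexU u -> brk (Pmx u Jmx) Jmx = 0 -> u = const_mx (1 / 3).
Proof.
move=> [_]; rewrite sum_ord3 => sumu com.
have s3 : (Num.sqrt 3 : R) != 0 by rewrite gt_eqF// sqrtr_gt0.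
have trZJ : trf (Zmx u) Jmx = - (2 / 3).
  rewrite trfE /Zmx !mxE /= !mulr0 mulr1 mulrN1 addr0 add0r.
  have -> : u 0 0 = 1 - u 0 1 - u 0 2 by lra.
  by field.
have e i j : brk (Pmx u Jmx) Jmx i j = 0 by rewrite com mxE.
have := e 0 1; have := e 0 0.
rewrite !brkE /Pmx trZJ /Zmx !mxE /= => e00 e01.
have u12 : u 0 1 = u 0 2.
  have : (u 0 1 - u 0 2) / Num.sqrt 3 = 0.
    have : (u 0 2 - u 0 1) / Num.sqrt 3 = - ((u 0 1 - u 0 2) / Num.sqrt 3).
      by rewrite -mulNr opprB.
    by lra.
  by move=> /eqP; rewrite mulf_eq0 invr_eq0 (negbTE s3) orbF subr_eq0 => /eqP.
have u0 : u 0 0 = 1 / 3 by lra.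
apply/matrixP => i j; rewrite mxE ord1.
have : [\/ j = 0, j = 1 | j = 2].
  by case: j => -[|[|[|//]]] ?;
    [constructor 1|constructor 2|constructor 3]; apply/val_inj.
by case=> ->; lra.
Qed.

(** * Hamiltonian without control *)

Lemma simplexU_vertex (R : realType) (k : 'I_3) :
  simplexU (delta_mx 0 k : 'rV[R]_3).
Proof.
split=> [i|]; first by rewrite mxE ler0n.
rewrite (bigD1 k)//= mxE !eqxx big1 ?addr0// => i ik.
by rewrite mxE (negbTE ik) andbF.
Qed.

Lemma hamiltonian_LR0 (R : realType) (lcost : R) (X L1 : 'M[R]_2)
    (u : 'rV[R]_3) :
  hamiltonian lcost X L1 0 u = trf (L1 - (3 / 2 * lcost) *: Jmx) X.
Proof. by rewrite /hamiltonian {2}/trf mul0mx mxtrace0 mul0r subr0. Qed.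

(** * Curves of rotations *)

Lemma is_derive_mx_coord (R : realType) (m n : nat) (f : R -> 'M[R]_(m, n))
    (t : R) (df : 'M[R]_(m, n)) i j :
  is_derive t (1 : R) f df -> is_derive t (1 : R) (fun s => f s i j) (df i j).
Proof.
move=> [dvf <-]; apply: DeriveDef; first exact: (derivable_mxP _ _ _).1.
by rewrite derive_mx// mxE.
Qed.

Definition rot (R : realType) (x : R) : 'M[R]_2 :=
  mx2 (cos x) (- sin x) (sin x) (cos x).

Lemma det_rot (R : realType) (x : R) : \det (rot x) = 1.
Proof. by rewrite det_mx22 !mxE /= -[RHS](cos2Dsin2 x); ring. Qed.

Lemma mul_rotN_rot (R : realType) (x : R) : rot (- x) *m rot x = 1%:M.
Proof.
have h := cos2Dsin2 x.
by apply: mx2_ext; rewrite mulmx2E !mxE /= cosN sinN -?h; ring.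
Qed.

Lemma mul_rot_unit_vec (R : realType) (x y : R) :
  rot x *m unit_vec y = unit_vec (y + x).
Proof.
apply/matrixP => i j; rewrite mulmx2E !mxE /= cosD sinD.
by case: ifP => _; ring.
Qed.

Lemma traces_circle_arc_rot (R : realType) (g : R -> 'M[R]_2) (h : 'M[R]_2)
    (t1 t2 phi : R) :
  {in `]t1, t2[, forall t, g t = h *m rot t} ->
  traces_circle_arc h t1 t2 (fun t => g t *m unit_vec phi).
Proof.
move=> gE; exists (fun t => phi + t), (phi + t1), (phi + t2); split.
- by move=> t _; apply: cvgD; [exact: cvg_cst|exact: cvg_id].
- split=> [t|x y _ _ /addrI //|s] /=; rewrite !in_itv/= ?ltrD2l//.
  move=> sI; exists (s - phi); last by rewrite addrC subrK.
  by rewrite in_itv/= ltrBrDl ltrBlDl.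
- by move=> t /gE ->; rewrite -mulmxA mul_rot_unit_vec.
Qed.

(** The product [K t] of [g t] and the rotation of angle [-t] has derivative
    zero, as [J] commutes with rotations; its entries are absolutely
    continuous, hence constant.  The constant is read off at the midpoint, since the
    equation concerns the open interval only. *)
Lemma ae_rotation_ode (R : realType) (a b : R) (g : R -> 'M[R]_2) :
  a < b -> abs_continuous a b g ->
  (\forall t \ae (@lebesgue_measure R),
     t \in `]a, b[ -> is_derive t (1 : R) g (g t *m Jmx)) ->
  {in `]a, b[, forall t,
    g t = g ((a + b) / 2) *m rot (- ((a + b) / 2)) *m rot t}.
Proof.
move=> ab acg gJ.
pose K t := g t *m rot (- t).
have KE i j : (fun t => K t i j) = if j == 0
    then (fun t => g t i 0 * cos t + - (g t i 1 * sin t))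
    else (fun t => g t i 0 * sin t + g t i 1 * cos t).
  case: eqP => j0; apply/funext => t; rewrite /K mulmx2E !mxE cosN sinN opprK /=.
    by rewrite j0 /= mulrN.
  by rewrite (negbTE (introN eqP j0)).
have acK i j : abs_continuous a b (fun t => K t i j).
  have acgi k := abs_continuous_mx_coord i k acg.
  have acs := abs_continuous_sin a b.
  have acc := abs_continuous_cos a b.
  rewrite KE; case: eqP => _.
    apply: abs_continuousD; last apply: abs_continuousN.
      exact: (abs_continuousM (acgi 0) acc).
    exact: (abs_continuousM (acgi 1) acs).
  apply: abs_continuousD; first exact: (abs_continuousM (acgi 0) acs).
  exact: (abs_continuousM (acgi 1) acc).
have K'0 i j : \forall t \ae (@lebesgue_measure R), t \in `]a, b[ ->
    is_derive t (1 : R) (fun t => K t i j) 0.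
  apply: filterS gJ => t /[apply] gt.
  have p' := is_derive_mx_coord i 0 gt.
  have q' := is_derive_mx_coord i 1 gt.
  rewrite mulmx2E !mxE /= mulr0 mulr1 add0r in p'.
  rewrite mulmx2E !mxE /= mulr0 mulrN1 addr0 in q'.
  by rewrite KE; case: eqP => _; apply: is_derive_eq; rewrite /GRing.scale/=; ring.
have Kle x y : a < x -> x <= y -> y < b -> K y = K x.
  move=> ax xy yb; apply/matrixP => i j.
  apply: (@abs_continuous_derive0 _ _ _ _ (fun t => K t i j)) => //.
    exact: abs_continuousS (ltW ax) (ltW yb) (acK i j).
  apply: filterS (K'0 i j) => t Kt txy; apply: Kt.
  move: txy; rewrite !in_itv/= => /andP[xt ty].
  by rewrite (lt_trans ax)// (lt_trans ty).
move=> t; rewrite in_itv/= => /andP[at_ tb].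
have -> : g t = K t *m rot t by rewrite -mulmxA mul_rotN_rot mulmx1.
congr (_ *m _); rewrite -/(K _).
by have [mt|/ltW tm] := leP ((a + b) / 2) t; [|apply/esym]; apply: Kle => //; lra.
Qed.

(** * The singular arc *)

Theorem theorem2p3p27 (R : realType) (tf : R) (g X L1 LR : R -> 'M[R]_2)
    (lcost : R) (u : R -> 'rV[R]_3) (t1 t2 : R)
    (ext : lifted_extremal tf g X L1 LR lcost u)
    (t1_ge0 : 0 <= t1) (t1_lt_t2 : t1 < t2) (t2_le_tf : t2 <= tf)
    (LR0 : forall t, t \in `[t1, t2] -> LR t = 0) :
  [/\ (\forall t \ae (@lebesgue_measure R), t \in `]t1, t2[ ->
         u t = const_mx (1 / 3) /\ Zmx (u t) = (1 / 3) *: Jmx),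
      singular_on t1 t2 X L1 LR lcost
    & exists h : 'M[R]_2, SL2 h /\
        forall j : nat, traces_circle_arc h t1 t2 (sigma g j)].
Proof.
have sub0 t : t \in `]t1, t2[ ->
    [/\ t \in `[0, tf], t \in `]0, tf[ & t \in `[t1, t2] ].
  rewrite !in_itv/= => /andP[t1t tt2].
  have t_gt0 : 0 < t by apply: le_lt_trans t1t.
  have t_lttf : t < tf by apply: lt_le_trans t2_le_tf.
  by rewrite t_gt0 t_lttf !ltW.
have cont (f : R -> 'M[R]_2) : abs_continuous 0 tf f ->
    {in `]t1, t2[, continuous f}.
  move=> /abs_continuous_within cf t /sub0[_ t0tf _].
  exact: within_continuous_continuous (le_tf_gt0 ext) cf t0tf.
have L1J t : t \in `]t1, t2[ -> L1 t = (3 / 2 * lcost) *: Jmx.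
  move: t.
  apply: ae_cst_continuous; first exact: cont (le_L1_ac ext).
  apply: filterS2 (le_ode ext) (le_ham0 ext) => t ode ham tI.
  have [t0tf t0tfo t12] := sub0 t tI.
  have [_ _ _] := ode t0tfo.
  rewrite LR0// => LR'.
  have LR0' s : s \in `]t1, t2[ -> LR s = 0 by move=> /sub0[_ _ /LR0].
  have := locally_constant_is_derive LR0' tI LR'.
  rewrite {1}/brk mulmx0 mul0mx subrr {1}/trf mul0mx mxtrace0 scale0r subrr add0r.
  move=> com; have := ham t0tf; rewrite LR0// hamiltonian_LR0 => tr0.
  apply/eqP; rewrite -subr_eq0; apply/eqP.
  apply: (@brk_trf_eq0 _ _ (X t)) => //.
  - rewrite /sl2 raddfB /= mxtraceZ (le_L1_sl2 ext)// mxtrace2E !mxE/=.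
    by rewrite addr0 mulr0 subrr.
  - exact: le_X_sl2 ext _ t0tf.
  - exact: le_X_det ext _ t0tf.
  - have -> : L1 t - (3 / 2 * lcost) *: Jmx =
        - (- L1 t + (3 / 2 * lcost) *: Jmx).
      by rewrite opprD opprK.
    by rewrite brkNl com oppr0.
have lcostN0 : 3 / 2 * lcost != 0.
  rewrite mulf_neq0//; apply/eqP => lc0; have mI : (t1 + t2) / 2 \in `]t1, t2[.
    by rewrite in_itv/=; apply/andP; split; lra.
  have [m0tf _ m12] := sub0 _ mI.
  apply: (le_nontrivial ext m0tf); split => //; last exact: LR0.
  by rewrite L1J// lc0 mulr0 scale0r.
have XJ t : t \in `]t1, t2[ -> X t = Jmx.
  move: t.
  apply: ae_cst_continuous; first exact: cont (le_X_ac ext).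
  apply: filterS (le_ode ext) => t ode tI.
  have [t0tf t0tfo _] := sub0 t tI.
  have [_ _ L1' _] := ode t0tfo.
  have := locally_constant_is_derive L1J tI L1'.
  rewrite L1J// /brk -scalemxAl -scalemxAr -scalerBr => /eqP.
  rewrite scaler_eq0 (negbTE lcostN0) => /eqP com.
  apply: brkJ_eq0 com; first exact: le_X_sl2 ext _ t0tf.
    exact: le_X_det ext _ t0tf.
  have [+ _] := le_X_star ext t0tf; apply: le_lt_trans.
  by rewrite mulr_ge0 ?sqrtr_ge0.
split.
- apply: filterS2 (le_ode ext) (le_u_simplex ext) => t ode simp tI.
  have [t0tf t0tfo _] := sub0 t tI.
  have [_ X' _ _] := ode t0tfo.
  have := locally_constant_is_derive XJ tI X'; rewrite XJ// => com.
  by rewrite (brkPJ_eq0 (simp t0tf) com) Zmx_center.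
- (* Any two controls will do; two vertices of the simplex are distinct. *)
  move=> t /sub0[_ _ t12].
  have all_max k : hmaximizer lcost (X t) (L1 t) (LR t) (delta_mx 0 k).
    split=> [|v _]; first exact: simplexU_vertex.
    by rewrite LR0// !hamiltonian_LR0.
  exists (delta_mx 0 0), (delta_mx 0 1); split; [|exact: all_max|exact: all_max].
  by move/matrixP/(_ 0 0)/eqP; rewrite !mxE eqxx oner_eq0.
- set m := (t1 + t2) / 2; exists (g m *m rot (- m)); split.
    rewrite /SL2 det_mulmx det_rot mulr1; apply: (le_g_SL2 ext).
    by case: (sub0 m) => //; rewrite in_itv/=; apply/andP; split; rewrite /m; lra.
  move=> j; apply: traces_circle_arc_rot; apply: ae_rotation_ode => //.
    exact: abs_continuousS t1_ge0 t2_le_tf (le_g_ac ext).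
  apply: filterS (le_ode ext) => t ode tI.
  have [_ t0tfo _] := sub0 t tI.
  by have [g' _ _ _] := ode t0tfo; rewrite XJ in g'.
Qed.
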